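(* Assume the setting and standing assumptions described in the context, and let $d>0$ be such that $\Xi\subset\Omega_d=\{z\in\mathbb{R}^{2n}:|z|<d\}$. Let $p\ge1$, $\epsilon>0$, and let $\delta_0,\dots,\delta_p\in\mathbb{R}$ satisfy: (1) $\mathcal{L}_F^p\phi(z)\le\sum_{i=0}^{p-1}\delta_i\mathcal{L}_F^i\phi(z)+\delta_p$ for all $z\in\Omega_d$; (2) $\delta_0\phi((x,0))+\delta_p\ge\epsilon$ for all $x\in\mathrm{Z}$; (3) $\delta_i\ge0$ for $i=0,\dots,p$. Let $r>0$ be such that $D=\{x\in\mathbb{R}^n:|x|=r\}\subset\mathrm{Z}$. Let $A$ be the $(p+1)\times(p+1)$ matrix with $A_{k,k+1}=1$ for $k=1,\dots,p-1$, $p$-th row $(\delta_0,\dots,\delta_{p-1},1)$, last row zero and all other entries zero; let $C=(1,0,\dots,0)$. For $x\in\mathbb{R}^n\setminus\{0\}$ and $t\ge0$ define $$\mu(x,t)=C\Big(\tfrac{|x|}{r}\Big)^{\theta+1}e^{A(\frac{|x|}{r})^{\alpha}t}\begin{bmatrix}\phi\big((r\tfrac{x}{|x|},0)\big)\\ \max\big(\mathcal{L}_F\phi((r\tfrac{x}{|x|},0)),0\big)\\ \vdots\\ \max\big(\mathcal{L}_F^{p-1}\phi((r\tfrac{x}{|x|},0)),0\big)\\ \delta_p\end{bmatrix}.$$ Then $\mu$ satisfies: (a) $\mu(x,0)<0$ for all $x\ne0$; (b) $\mu(x,t)\ge\phi(\xi(t;x))$ for all $t\in[0,\tau(x)]$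 and all $x\neq0$; (c) $\mu(\lambda x,t)=\lambda^{\theta+1}\mu(x,\lambda^\alpha t)$ for all $t,\lambda>0$, $x\ne0$; (d) for every $x\ne0$ there exists a unique $\tau_x$ with $\mu(x,\tau_x)=0$.
   Context: Let $f:\mathbb{R}^n\times\mathbb{R}^m\to\mathbb{R}^n$ and a feedback law $\upsilon:\mathbb{R}^n\to\mathbb{R}^m$ be given. Define $F:\mathbb{R}^{2n}\to\mathbb{R}^{2n}$ by $F(z,e)=\big(f(z,\upsilon(z+e)),\,-f(z,\upsilon(z+e))\big)$. For $x\in\mathbb{R}^n$, $\xi(t;x)$ denotes the solution of $\dot\xi=F(\xi)$ with $\xi(0;x)=(x,0)$. A triggering function $\phi:\mathbb{R}^{2n}\to\mathbb{R}$ is given, and $\tau(x)=\inf\{t>0:\phi(\xi(t;x))=0\}$. $\mathcal{L}_F^k\phi$ denotes the $k$-th Lie derivative of $\phi$ along $F$ ($\mathcal{L}_F^0\phi=\phi$). Standing assumptions: (i) $F$ is smooth and homogeneous of degree $\alpha\ge1$ with all weights $1$, i.e. $F(\lambda\xi)=\lambda^{\alpha+1}F(\xi)$ for all $\lambda>0$; (ii) $\phi$ is smooth and homogeneous of degree $\theta\ge1$ with weights $1$, i.e. $\phi(\lambda\xi)=\lambda^{\theta+1}\phi(\xi)$ for all $\lambda>0$; (iii) for every $x\ne0$, $\phi((x,0))<0$ and there exists $t_x\in(0,\infty)$ with $\phi(\xi(t_x;x))=0$; (iv) compact sets $\mathrm{Z}\subset\mathbb{R}^n$, $\Xi\subset\mathbb{R}^{2n}$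 containing a neighbourhood of the origin are given such that for all $x\in\mathrm{Z}$, $t\ge0$: $\phi(\xi(t;x))\le0\Rightarrow\xi(t;x)\in\Xi$; (v) the origin is the only equilibrium of $\dot\zeta=f(\zeta,\upsilon(\zeta))$. *)

(* Defs.v *)
From HB Require Import structures.
From mathcomp Require Import all_boot all_order all_algebra.
From mathcomp Require Import all_classical all_reals all_analysis.
Set Implicit Arguments. Unset Strict Implicit. Unset Printing Implicit Defensive.
Import Order.TTheory GRing.Theory Num.Theory.
Import numFieldNormedType.Exports.
Local Open Scope classical_set_scope.
Local Open Scope ring_scope.

Section Defs.
Variable R : realType.

Definition enorm (k : nat) (x : 'rV[R]_k) : R :=
  Num.sqrt (\sum_(i < k) x ord0 i ^+ 2).

Definition pair_st (n : nat) (z e : 'rV[R]_n) : 'rV[R]_(n + n) := row_mx z e.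

Definition Fcl (n m : nat) (f : 'rV[R]_n -> 'rV[R]_m -> 'rV[R]_n)
  (ups : 'rV[R]_n -> 'rV[R]_m) (w : 'rV[R]_(n + n)) : 'rV[R]_(n + n) :=
  let z := lsubmx w in let e := rsubmx w in
  row_mx (f z (ups (z + e))) (- f z (ups (z + e))).

Fixpoint iterD (V W : normedModType R) (vs : seq V) (g : V -> W) : V -> W :=
  match vs with
  | [::] => g
  | v :: vs' => fun x => 'D_v (iterD vs' g) x
  end.

Definition smooth (V W : normedModType R) (g : V -> W) : Prop :=
  forall (vs : seq V) (x : V), differentiable (iterD vs g) x.

(* homogeneity with all weights 1: g (lam x) = lam^(deg+1) g x, lam > 0 *)
Definition homogeneous (V W : normedModType R) (deg : R) (g : V -> W) : Prop :=
  forall (lam : R) (x : V), 0 < lam -> g (lam *: x) = (lam `^ (deg + 1)) *: g x.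

Fixpoint lie (V : normedModType R) (F : V -> V) (k : nat) (phi : V -> R) : V -> R :=
  match k with
  | 0 => phi
  | k'.+1 => fun z => 'D_(F z) (lie F k' phi) z
  end.

Definition expm (k : nat) (M : 'M[R]_k.+1) : 'M[R]_k.+1 :=
  \matrix_(i, j) limn (series (fun l : nat => (M ^+ l) i j / (l`!)%:R)).

Definition Amat (p : nat) (delta : nat -> R) : 'M[R]_p.+1 :=
  \matrix_(i, j)
    if (i.+1 < p)%N then (if j == i.+1 :> nat then 1 else 0)
    else if i == p.-1 :> nat then (if (j < p)%N then delta j else 1)
    else 0.

Definition Crow (p : nat) : 'rV[R]_p.+1 := \row_j (if j == 0 :> nat then 1 else 0).

Definition mu_vec (n p : nat) (F : 'rV[R]_(n + n) -> 'rV[R]_(n + n))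
  (phi : 'rV[R]_(n + n) -> R) (delta : nat -> R) (y : 'rV[R]_n) : 'cV[R]_p.+1 :=
  \col_i (if i == 0 :> nat then phi (pair_st y 0)
          else if (i < p)%N then Num.max (lie F i phi (pair_st y 0)) 0
          else delta p).

Definition mu (n p : nat) (F : 'rV[R]_(n + n) -> 'rV[R]_(n + n))
  (phi : 'rV[R]_(n + n) -> R) (delta : nat -> R) (alpha theta r : R)
  (x : 'rV[R]_n) (t : R) : R :=
  let s := enorm x / r in
  ((Crow p *m ((s `^ (theta + 1)) *: expm ((s `^ alpha * t) *: Amat p delta)))
     *m mu_vec p F phi delta (r / enorm x *: x)) ord0 ord0.

(* triggering time tau(x) = inf {t > 0 : phi(xi(t;x)) = 0}, where xi(.;x) is
   only considered on its interval of existence [0, T x) *)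
Definition trig_time (n : nat) (phi : 'rV[R]_(n + n) -> R)
  (xi : 'rV[R]_n -> R -> 'rV[R]_(n + n)) (T : 'rV[R]_n -> \bar R) (x : 'rV[R]_n) : R :=
  inf [set t : R | 0 < t /\ (t%:E < T x)%E /\ phi (xi x t) = 0].

End Defs.

(* Main.v *)
(** Along a trajectory starting on the sphere |x| = r the functions
    h_i = L_F^i phi satisfy h_i' = h_(i+1), and the differential inequality (1)
    closes this chain.  The components of the matrix exponential satisfy the
    same companion system with equality.  As the delta_i are nonnegative, the
    system is cooperative, so solutions stay above subsolutions: this is (b) on
    the sphere.  Homogeneity of F and uniqueness of solutions give
    xi(t; s y) = s xi(s^alpha t; y), which transports (b), and with it the
    triggering times, to all x <> 0.  For (d), comparison with the constant
    subsolution (phi(y, 0), 0, ..., 0) shows that the last component of the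
    system grows at speed at least eps; integrating p times, mu(x, .) is
    strictly increasing and unbounded. *)

Require Import Defs.
From HB Require Import structures.
From mathcomp Require Import all_boot all_order all_algebra.
From mathcomp Require Import all_classical all_reals all_analysis.
From mathcomp Require Import ring.
Import Order.TTheory GRing.Theory Num.Theory.
Import numFieldNormedType.Exports.
Local Open Scope classical_set_scope.
Local Open Scope ring_scope.

Set Implicit Arguments.
Unset Strict Implicit.

(** * Differential inequalities *)

Lemma is_derive_continuous (R : realType) (V : normedModType R) (g : R -> V)
  (t : R) (dg : V) : is_derive t 1 g dg -> {for t, continuous g}.
Proof.
by move=> [dgt _]; apply/differentiable_continuous/derivable1_diffP.
Qed.

Lemma is_derive_within_continuous (R : realType) (V : normedModType R)
  (g dg : R -> V) (a b : R) :
  (forall t, a <= t <= b -> is_derive t 1 g (dg t)) ->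
  {within `[a, b], continuous g}.
Proof.
move=> dgP; apply: derivable_within_continuous => t; rewrite in_itv /= => tab.
by case: (dgP t tab).
Qed.

Lemma is_derive_MVT (R : realType) (g dg : R -> R) (a b : R) : a < b ->
  (forall t, a <= t <= b -> is_derive t 1 g (dg t)) ->
  exists2 c, a < c < b & g b - g a = dg c * (b - a).
Proof.
move=> ab dgP.
have [|c] := @MVT R g dg a b ab _ (is_derive_within_continuous dgP).
  by move=> t; rewrite in_itv /= => /andP[at_ tb]; apply: dgP; rewrite !ltW.
by rewrite in_itv; exists c.
Qed.

Lemma is_derive_ge0_le (R : realType) (g dg : R -> R) (a b : R) : a <= b ->
  (forall t, a <= t <= b -> is_derive t 1 g (dg t)) ->
  (forall t, a < t < b -> 0 <= dg t) -> g a <= g b.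
Proof.
rewrite le_eqVlt => /orP[/eqP-> //|ab] dgP dg_ge0.
have [c cab gE] := is_derive_MVT ab dgP.
by rewrite -subr_ge0 gE mulr_ge0 ?dg_ge0 // subr_ge0 ltW.
Qed.

Lemma is_derive_gt0_lt (R : realType) (g dg : R -> R) (a b : R) : a < b ->
  (forall t, a <= t <= b -> is_derive t 1 g (dg t)) ->
  (forall t, a < t < b -> 0 < dg t) -> g a < g b.
Proof.
move=> ab dgP dg_gt0; have [c cab gE] := is_derive_MVT ab dgP.
by rewrite -subr_gt0 gE mulr_gt0 ?dg_gt0 // subr_gt0.
Qed.

Lemma is_derive_mulrl (R : realType) (k t : R) : is_derive t 1 ( *%R k) k.
Proof. by apply: is_derive_eq; rewrite /GRing.scale /= mulr1. Qed.

Lemma is_derive_expRM (R : realType) (k t : R) :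
  is_derive t 1 (fun u : R => expR (k * u)) (k * expR (k * t)).
Proof.
have := is_derive1_comp (is_derive_expR (k * t)) (is_derive_mulrl k t).
by rewrite mulrC.
Qed.

Lemma real_induction (R : realType) (a b : R) (P : R -> Prop) :
  (forall t, a <= t <= b -> (forall s, a <= s < t -> P s) -> P t) ->
  (forall t, a <= t < b -> P t -> \forall s \near t^'+, P s) ->
  forall t, a <= t <= b -> P t.
Proof.
move=> P_limit P_extends t0 /[dup] /andP[at0 t0b] t0ab; apply: contrapT => nPt0.
pose S := [set t : R | a <= t <= b /\ ~ P t].
have St0 : S t0 by [].
have lbS : has_lbound S by exists a => t [/andP[]].
have infS : has_inf S by split; first exists t0.
pose s := inf S.
have as_ : a <= s by apply: lb_le_inf => [|t [/andP[]] //]; exists t0.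
have s_le t : S t -> s <= t by move=> St; apply: ge_inf.
have sb : s <= b := le_trans (s_le t0 St0) t0b.
have Ps : P s.
  apply: P_limit => [|t /andP[at_ ts]]; first by rewrite as_.
  apply: contrapT => nPt; have : s <= t.
    by apply: s_le; split=> //; rewrite at_ (le_trans (ltW ts)).
  by rewrite leNgt ts.
have s_lt t : S t -> s < t.
  move=> St; rewrite lt_neqAle s_le // andbT.
  by apply/eqP => st; case: St => _; rewrite -st.
have /P_extends/(_ Ps) : a <= s < b by rewrite as_ (lt_le_trans (s_lt t0 St0)).
case=> e /= e0 P_near; have [t St te] := inf_adherent e0 infS.
by case: (St) => _; apply; apply: P_near (s_lt t St);
  rewrite /ball_ /= distrC ger0_norm ?subr_ge0 ?s_le // ltrBlDl.
Qed.

(* As long as all components are positive they are nondecreasing. *)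
Lemma cooperative_gt0 (R : realType) (I : finType) (B : I -> I -> R) (b : R)
  (w dw : I -> R -> R) : (forall i j, 0 <= B i j) ->
  (forall i t, 0 <= t <= b -> is_derive t 1 (w i) (dw i t)) ->
  (forall i t, 0 <= t <= b -> \sum_j B i j * w j t <= dw i t) ->
  (forall i, 0 < w i 0) -> forall i t, 0 <= t <= b -> 0 < w i t.
Proof.
move=> B_ge0 dwP dw_ge w0 i t tb; move: t tb i.
apply: real_induction => [t /andP[t_ge0 tb] w_gt0 i|t /andP[t_ge0 /ltW tb] wt].
  apply: lt_le_trans (w0 i) _.
  apply: (@is_derive_ge0_le _ _ (dw i)) => // s /andP[s_ge0 st].
    by apply: dwP; rewrite s_ge0 (le_trans st).
  apply: le_trans (dw_ge i s _); last by rewrite ltW ?(le_trans (ltW st)).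
  by apply: sumr_ge0 => j _; rewrite mulr_ge0 // ltW // w_gt0 // ltW.
apply: filter_forall => i; apply: cvgr_gt (wt i); apply: cvg_at_right_filter.
by apply: is_derive_continuous (dwP i t _); rewrite t_ge0.
Qed.

Lemma cooperative_ge0 (R : realType) (I : finType) (B : I -> I -> R) (b : R)
  (w dw : I -> R -> R) : (forall i j, 0 <= B i j) ->
  (forall i t, 0 <= t <= b -> is_derive t 1 (w i) (dw i t)) ->
  (forall i t, 0 <= t <= b -> \sum_j B i j * w j t <= dw i t) ->
  (forall i, 0 <= w i 0) -> forall i t, 0 <= t <= b -> 0 <= w i t.
Proof.
move=> B_ge0 dwP dw_ge w0 i t tb.
pose K := \sum_i \sum_j B i j.
apply/ler_addgt0Pr => e e0.
pose c := e / expR (K * t).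
have c0 : 0 < c by rewrite divr_gt0 ?expR_gt0.
have -> : e = c * expR (K * t) by rewrite divfK // gt_eqF ?expR_gt0.
apply/ltW/(@cooperative_gt0 _ _ B b (fun i t => w i t + c * expR (K * t))
  (fun i t => dw i t + c * (K * expR (K * t)))) => // [j s sb|j s sb|j].
- exact: is_deriveD (dwP j s sb) (is_deriveZ _ (is_derive_expRM K s)).
- under eq_bigr => l _ do rewrite mulrDr.
  rewrite big_split /= -mulr_suml lerD ?dw_ge // mulrCA.
  rewrite ler_pM2l // ler_pM2r ?expR_gt0 // /K [leRHS](bigD1 j) //= lerDl.
  by do 2![apply: sumr_ge0 => ? _].
- by rewrite ltr_wpDl // mulr_gt0 ?expR_gt0.
Qed.

Lemma gronwall_le0 (R : realType) (g dg : R -> R) (K b : R) : 0 <= K ->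
  (forall t, 0 <= t <= b -> is_derive t 1 g (dg t)) ->
  (forall t, 0 <= t <= b -> dg t <= K * g t) ->
  g 0 <= 0 -> forall t, 0 <= t <= b -> g t <= 0.
Proof.
move=> K0 dgP dg_le g0 t tb; rewrite -oppr_ge0.
apply: (@cooperative_ge0 _ unit (fun _ _ => K) b (fun _ s => - g s)
  (fun _ s => - dg s)) => // [_ s sb|_ s sb|_].
- by have := dgP s sb; apply: is_deriveN.
- by rewrite big_const card_unit /= addr0 mulrN lerN2 dg_le.
- by rewrite oppr_ge0.
Qed.

(** * Norms of vectors *)

Lemma mx_norm_leP (R : realType) (m n : nat) (M : 'M[R]_(m, n)) (C : R) :
  0 <= C -> `|M| <= C <-> forall i j, `|M i j| <= C.
Proof.
move=> C0; rewrite [in X in X <-> _]/Num.Def.normr /= mx_normrE.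
split=> [/bigmax_leP[_ MC] i j|MC]; first exact: (MC (i, j)).
by apply: bigmax_le => // -[i j] _; exact: MC.
Qed.

Lemma mx_norm_coord_le (R : realType) (m n : nat) (M : 'M[R]_(m, n)) i j :
  `|M i j| <= `|M|.
Proof. exact: (mx_norm_leP M (normr_ge0 M)).1. Qed.

Lemma sqr_enorm (R : realType) (n : nat) (x : 'rV[R]_n) :
  enorm x ^+ 2 = \sum_i x ord0 i ^+ 2.
Proof. by rewrite sqr_sqrtr // sumr_ge0 // => i _; exact: sqr_ge0. Qed.

Lemma mx_norm_le_enorm (R : realType) (n : nat) (x : 'rV[R]_n) :
  `|x| <= enorm x.
Proof.
apply/mx_norm_leP => [|j i]; first exact: sqrtr_ge0.
rewrite (ord1 j) -sqrtr_sqr ler_wsqrtr // (bigD1 i) //= lerDl.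
by apply: sumr_ge0 => l _; exact: sqr_ge0.
Qed.

Lemma enorm_gt0 (R : realType) (n : nat) (x : 'rV[R]_n) : x != 0 -> 0 < enorm x.
Proof.
by rewrite -normr_gt0 => /lt_le_trans; apply; exact: mx_norm_le_enorm.
Qed.

Lemma enormZ (R : realType) (n : nat) (lam : R) (x : 'rV[R]_n) :
  0 <= lam -> enorm (lam *: x) = lam * enorm x.
Proof.
move=> lam0.
rewrite /enorm -[in RHS](ger0_norm lam0) -sqrtr_sqr -sqrtrM ?sqr_ge0 //.
by rewrite mulr_sumr; congr Num.sqrt; apply: eq_bigr => i _; rewrite mxE exprMn.
Qed.

(** * Matrix exponentials *)

Definition egf (R : realType) (a : nat -> R) (t : R) : R :=
  limn (pseries (fun l => a l / l`!%:R) t).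

Definition geometrically_bounded (R : realType) (a : nat -> R) : Prop :=
  exists C M : R, 0 <= M /\ forall l, `|a l| <= C * M ^+ l.

Section ExponentialGeneratingFunction.
Variable R : realType.
Implicit Types (a : nat -> R) (t : R).

Lemma geometrically_bounded_shift a :
  geometrically_bounded a -> geometrically_bounded (fun l => a l.+1).
Proof.
by case=> C [M [M0 aM]]; exists (C * M), M; split=> // l; rewrite -mulrA -exprS.
Qed.

Lemma is_cvg_egf a t :
  geometrically_bounded a -> cvgn (pseries (fun l => a l / l`!%:R) t).
Proof.
move=> [C [M [M0 aM]]].
have C0 : 0 <= C by have := aM 0%N; rewrite expr0 mulr1; apply: le_trans.
apply/normed_cvg.
apply: (@series_le_cvg _ _ (fun l => C * exp_coeff (M * `|t|) l)) => /=.
- by move=> l.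
- by move=> l; rewrite mulr_ge0 // exp_coeff_ge0 // mulr_ge0.
- move=> l; rewrite !normrM /exp_coeff /= exprMn normrX normfV normr_nat.
  rewrite mulrAC !mulrA ler_wpM2r ?invr_ge0 ?ler0n //.
  by rewrite ler_wpM2r ?exprn_ge0.
- exact/is_cvg_seriesZ/is_cvg_series_exp_coeff.
Qed.

Lemma pseries_diffs_fact a :
  pseries_diffs (fun l => a l / l`!%:R) = (fun l => a l.+1 / l`!%:R).
Proof.
apply/funext => l; rewrite /pseries_diffs factS natrM invfM.
by rewrite mulrCA mulVKf // pnatr_eq0.
Qed.

Lemma is_derive_egf a t : geometrically_bounded a ->
  is_derive t 1 (egf a) (egf (fun l => a l.+1) t).
Proof.
move=> aP; rewrite /egf -pseries_diffs_fact.
apply: (@pseries_snd_diffs _ _ (`|t| + 1)); rewrite ?pseries_diffs_fact.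
- exact: is_cvg_egf.
- exact: is_cvg_egf (geometrically_bounded_shift aP).
- exact: is_cvg_egf
    (geometrically_bounded_shift (geometrically_bounded_shift aP)).
- by rewrite [ltRHS]ger0_norm ?addr_ge0 // ltrDl.
Qed.

Lemma egf0 a : egf a 0 = a 0%N.
Proof.
apply/cvg_lim => //; rewrite -(cvg_shiftS _).
rewrite (_ : (fun n => _) = cst (a 0%N)); first exact: cvg_cst.
apply/funext => n; rewrite /pseries /series /= big_nat_recl //.
rewrite big1 => [|l _]; last by rewrite expr0n mulr0.
by rewrite fact0 divr1 expr0 mulr1 addr0.
Qed.

Lemma egf_sum (I : finType) (c : I -> R) (a : I -> nat -> R) t :
  (forall i, geometrically_bounded (a i)) ->
  egf (fun l => \sum_i c i * a i l) t = \sum_i c i * egf (a i) t.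
Proof.
move=> aP; apply: cvg_lim => //.
rewrite (_ : pseries _ t =
    fun n => \sum_i c i * pseries (fun l => a i l / l`!%:R) t n); last first.
  apply/funext => n; rewrite /pseries /series /=.
  under [RHS]eq_bigr do rewrite mulr_sumr.
  rewrite exchange_big /=; apply: eq_bigr => l _.
  by rewrite !mulr_suml; apply: eq_bigr => i _; rewrite !mulrA.
apply: cvg_big => [|i _]; first exact: add_continuous.
by apply: cvgMl_tmp; apply: is_cvg_egf.
Qed.

End ExponentialGeneratingFunction.

Section MatrixExponential.
Variables (R : realType) (k : nat).
Implicit Types A : 'M[R]_k.+1.

Lemma expm_egf A t i j : expm (t *: A) i j = egf (fun l => (A ^+ l) i j) t.
Proof.
rewrite mxE /egf /pseries; congr (limn (series _)); apply/funext => l /=.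
by rewrite exprZn mxE [RHS]mulrC mulrA.
Qed.

Lemma expm0 : expm (0 : 'M[R]_k.+1) = 1%:M.
Proof. by apply/matrixP => i j; rewrite -(scale0r 0) expm_egf egf0. Qed.

Lemma geometrically_bounded_expr_mx A i j :
  geometrically_bounded (fun l => (A ^+ l) i j).
Proof.
pose M := \sum_i \sum_j `|A i j|.
exists 1, M; split=> [|l]; first by do 2![apply: sumr_ge0 => ? _].
rewrite mul1r; elim: l i j => [|l ih] i j.
  by rewrite !expr0 mxE; case: (_ == _); rewrite ?normr1 ?normr0.
rewrite !exprSr -mulmxE mxE (le_trans (ler_norm_sum _ _ _)) //.
rewrite /M mulr_sumr; apply: ler_sum => h _.
rewrite normrM ler_pM //.
by rewrite (bigD1 j) //= lerDl sumr_ge0.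
Qed.

Lemma is_derive_expm A (t : R) i j :
  is_derive t 1 (fun u => expm (u *: A) i j) ((A *m expm (t *: A)) i j).
Proof.
rewrite (_ : (fun _ => _) = egf (fun l => (A ^+ l) i j)); last first.
  by apply/funext => u; exact: expm_egf.
apply: is_derive_eq (is_derive_egf t (geometrically_bounded_expr_mx A i j)) _.
rewrite mxE; under [RHS]eq_bigr do rewrite expm_egf.
rewrite -egf_sum => [|h]; last exact: geometrically_bounded_expr_mx.
by congr (egf _ t); apply/funext => l; rewrite exprS -mulmxE mxE.
Qed.

Lemma is_derive_expm_mulmx n A (v : 'M[R]_(k.+1, n)) (t : R) i j :
  is_derive t 1 (fun u => (expm (u *: A) *m v) i j)
    ((A *m (expm (t *: A) *m v)) i j).
Proof.
rewrite (_ : (fun _ => _) = \sum_h v h j \*: (fun u => expm (u *: A) i h)).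
  apply: is_derive_eq (is_derive_sum (fun h =>
    is_deriveZ (v h j) (is_derive_expm A t i h))) _.
  by rewrite mulmxA [RHS]mxE; apply: eq_bigr => h _; rewrite mulrC.
apply/funext => u; rewrite mxE fct_sumE.
by apply: eq_bigr => h _; rewrite mulrC.
Qed.

End MatrixExponential.

(** * Smooth functions and Lie derivatives *)

Lemma is_derive_comp_diff (R : realType) (V W : normedModType R) (g : V -> W)
  (u : R -> V) (t : R) (du : V) :
  differentiable g (u t) -> is_derive t 1 u du ->
  is_derive t 1 (g \o u) ('D_du g (u t)).
Proof.
move=> dg [/derivable1_diffP du_t <-].
have dgu : differentiable (g \o u) t by apply: differentiable_comp.
apply: DeriveDef; first exact/derivable1_diffP.
by rewrite !deriveE // diff_comp.
Qed.

Lemma is_derive_coord (R : realType) (V : normedModType R) (m n : nat)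
  (g : V -> 'M[R]_(m, n)) (x v : V) (dg : 'M[R]_(m, n)) i j :
  is_derive x v g dg -> is_derive x v (fun y => g y i j) (dg i j).
Proof.
move=> [gx <-]; apply: DeriveDef; first exact: (derivable_mxP g x v).1.
by rewrite derive_mx // mxE.
Qed.

Lemma derive_delta_sum (R : realType) (n : nat) (W : normedModType R)
  (g : 'rV[R]_n -> W) x v : differentiable g x ->
  'D_v g x = \sum_j v ord0 j *: 'D_(delta_mx ord0 j) g x.
Proof.
move=> dg; rewrite deriveE // [in LHS](row_sum_delta v) linear_sum.
by apply: eq_bigr => j _; rewrite linearZ deriveE.
Qed.

Local Notation iterD := Defs.iterD.

Section Smooth.
Variables (R : realType) (V W : normedModType R).
Implicit Type g : V -> W.

Lemma smooth_differentiable g x : smooth g -> differentiable g x.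
Proof. by move=> sg; exact: (sg [::]). Qed.

Lemma smooth_continuous g : smooth g -> continuous g.
Proof.
by move=> sg x; apply: differentiable_continuous; exact: smooth_differentiable.
Qed.

Lemma smooth_derive g v : smooth g -> smooth ('D_v g).
Proof.
have iterD_rcons vs : iterD (rcons vs v) g = iterD vs ('D_v g).
  by elim: vs => //= u vs ->.
by move=> sg vs x; rewrite -iterD_rcons.
Qed.

End Smooth.

Section SmoothAlgebra.
Variables (R : realType) (V : normedModType R).

(* Closed under directional derivatives by Leibniz' rule, unlike the set of
   sums or products of two smooth functions. *)
Inductive smooth_algebra : (V -> R) -> Prop :=
| smooth_algebra_smooth f : smooth f -> smooth_algebra f
| smooth_algebra_add f g :
    smooth_algebra f -> smooth_algebra g -> smooth_algebra (f + g)
| smooth_algebra_mul f g :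
    smooth_algebra f -> smooth_algebra g -> smooth_algebra (f * g).

Lemma smooth_algebra_differentiable f x :
  smooth_algebra f -> differentiable f x.
Proof.
elim=> {f} [f /smooth_differentiable //|f g _ df _ dg|f g _ df _ dg].
  exact: differentiableD.
exact: differentiableM.
Qed.

Lemma smooth_algebra_derive f v :
  smooth_algebra f -> smooth_algebra ('D_v f).
Proof.
elim=> {f} [f sf|f g sf sdf sg sdg|f g sf sdf sg sdg].
- exact/smooth_algebra_smooth/smooth_derive.
- rewrite (_ : 'D_v (f + g) = 'D_v f + 'D_v g); first exact: smooth_algebra_add.
  by apply/funext => x; rewrite deriveD //; apply: diff_derivable;
    exact: smooth_algebra_differentiable.
- rewrite (_ : 'D_v (f * g) = f * 'D_v g + g * 'D_v f).
    by apply: smooth_algebra_add; exact: smooth_algebra_mul.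
  by apply/funext => x; rewrite deriveM //; apply: diff_derivable;
    exact: smooth_algebra_differentiable.
Qed.

Lemma smooth_algebraP f : smooth_algebra f -> smooth f.
Proof.
move=> sf vs x; apply: smooth_algebra_differentiable.
by elim: vs => //= v vs; exact: smooth_algebra_derive.
Qed.

Lemma smoothD (f g : V -> R) : smooth f -> smooth g -> smooth (f + g).
Proof.
by move=> sf sg; apply/smooth_algebraP/smooth_algebra_add;
  exact: smooth_algebra_smooth.
Qed.

Lemma smoothM (f g : V -> R) : smooth f -> smooth g -> smooth (f * g).
Proof.
by move=> sf sg; apply/smooth_algebraP/smooth_algebra_mul;
  exact: smooth_algebra_smooth.
Qed.

Lemma smooth0 : smooth (0 : V -> R).
Proof.
have iterD0 vs : iterD vs (0 : V -> R) = 0.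
  by elim: vs => //= v vs ->; apply/funext => x; exact: derive_cst.
by move=> vs x; rewrite iterD0; exact: differentiable_cst.
Qed.

Lemma smooth_sum (I : finType) (f : I -> V -> R) :
  (forall i, smooth (f i)) -> smooth (\sum_i f i).
Proof.
by move=> sf; elim/big_ind: _ => //; [exact: smooth0|exact: smoothD].
Qed.

Lemma smooth_coord (m n : nat) (F : V -> 'M[R]_(m, n)) i j :
  smooth F -> smooth (fun x => F x i j).
Proof.
move=> sF; have iterD_coord vs :
    iterD vs (fun x => F x i j) = fun x => iterD vs F x i j.
  elim: vs => //= v vs ->; apply/funext => x.
  by rewrite derive_mx ?mxE //; apply: diff_derivable; exact: sF.
move=> vs x; rewrite iterD_coord.
exact: differentiable_comp (sF vs x) (differentiable_coord _ _ _).
Qed.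

End SmoothAlgebra.

Lemma smooth_lie (R : realType) (n : nat) (F : 'rV[R]_n -> 'rV[R]_n)
  (phi : 'rV[R]_n -> R) k : smooth F -> smooth phi -> smooth (lie F k phi).
Proof.
move=> sF sphi; elim: k => [//|k ih] /=.
rewrite (_ : (fun z => _) =
    \sum_j (fun z => F z ord0 j) * 'D_(delta_mx ord0 j) (lie F k phi)).
  apply: smooth_sum => j; apply: smoothM; first exact: smooth_coord.
  exact: smooth_derive.
apply/funext => z; rewrite derive_delta_sum ?fct_sumE //.
exact: smooth_differentiable.
Qed.

(** * Uniqueness of solutions *)

Lemma compact_norm_ball (R : realType) (n : nat) (B : R) :
  compact [set z : 'rV[R]_n | `|z| <= B].
Proof.
apply: bounded_closed_compact.
  exists B; split=> [|M BM z /= /le_trans]; first exact: num_real.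
  by apply; exact: ltW.
rewrite (_ : mkset _ = Num.norm @^-1` [set y : R | y <= B]) //.
apply: preimage_closed (@closed_le _ B) => z _; exact: norm_continuous.
Qed.

Lemma is_derive_line (R : realType) (V : normedModType R) (b v : V) (t : R) :
  is_derive t 1 (fun s : R => b + s *: v) v.
Proof.
rewrite -[v in is_derive _ _ _ v]add0r; apply: is_deriveD.
apply: DeriveDef; first exact/derivable1_diffP.
by rewrite deriveE // diff_val scale1r.
Qed.

Lemma ler_norm_sub_derive (R : realType) (V : normedModType R) (m n : nat)
  (F : V -> 'M[R]_(m, n)) (a b : V) (C : R) :
  (forall z, differentiable F z) -> 0 <= C ->
  (forall s : R, 0 <= s <= 1 -> `|'D_(a - b) F (b + s *: (a - b))| <= C) ->
  `|F a - F b| <= C.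
Proof.
move=> dF C0 FC; apply/mx_norm_leP => // i j; rewrite !mxE.
pose g (s : R) : R := F (b + s *: (a - b)) i j.
pose dg (s : R) : R := ('D_(a - b) F (b + s *: (a - b))) i j.
have dgP (s : R) : is_derive s 1 g (dg s).
  apply/is_derive_coord/is_derive_comp_diff => //.
  exact: is_derive_line.
have [c c01] := @is_derive_MVT _ g dg 0 1 ltr01 (fun s _ => dgP s).
rewrite /g scale0r addr0 scale1r subr0 mulr1 (addrC b) subrK => gE.
rewrite gE (le_trans (mx_norm_coord_le _ _ _)) // FC //.
by case/andP: c01 => *; rewrite !ltW.
Qed.

Lemma smooth_derive_bounded (R : realType) (n : nat) (W : normedModType R)
  (F : 'rV[R]_n -> W) (A : set 'rV[R]_n) : smooth F -> compact A ->
  exists2 L, 0 <= L & forall z v, A z -> `|'D_v F z| <= L * `|v|.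
Proof.
move=> sF cA.
pose S z := \sum_j `|'D_(delta_mx ord0 j) F z|.
have cS : continuous S.
  apply: continuous_big => [|j _ z]; first exact: add_continuous.
  apply: (@continuous_comp _ _ _ (derive F ^~ _) Num.norm).
    exact/smooth_continuous/smooth_derive.
  exact: norm_continuous.
have /compact_bounded/ex_strict_bound_gt0[L L0 SL] :=
  continuous_compact (continuous_subspaceT cS) cA.
exists L; first exact: ltW.
move=> z v Az; rewrite derive_delta_sum; last exact: smooth_differentiable.
apply: le_trans (ler_norm_sum _ _ _) _.
apply: (@le_trans _ _ (S z * `|v|)).
  rewrite mulr_suml; apply: ler_sum => j _.
  by rewrite normrZ mulrC ler_wpM2l // mx_norm_coord_le.
by rewrite ler_wpM2r // (le_trans (ler_norm _)) // ltW // SL //; exists z.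
Qed.

Lemma smooth_lipschitz (R : realType) (m n : nat) (F : 'rV[R]_n -> 'rV[R]_m)
  (A : set 'rV[R]_n) : smooth F -> bounded_set A ->
  exists2 L, 0 <= L & L.-lipschitz_A F.
Proof.
move=> sF /ex_strict_bound_gt0[B _ AB].
have [L L0 FL] := smooth_derive_bounded sF (@compact_norm_ball _ n B).
exists L => // -[a b] /= [/AB/ltW aB /AB/ltW bB].
apply: ler_norm_sub_derive => [z||s /andP[s0 s1]].
- exact: smooth_differentiable.
- by rewrite mulr_ge0.
apply: FL => /=; rewrite (_ : b + _ = (1 - s) *: b + s *: a); last first.
  by rewrite scalerBl scale1r scalerBr addrAC addrA.
rewrite (le_trans (ler_normD _ _)) // !normrZ (ger0_norm s0).
rewrite ger0_norm ?subr_ge0 //.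
have -> : B = (1 - s) * B + s * B by ring.
by rewrite lerD // ler_wpM2l // subr_ge0.
Qed.

Lemma is_derive_sqr_enorm (R : realType) (n : nat) (w : R -> 'rV[R]_n) (t : R)
  (dw : 'rV[R]_n) : is_derive t 1 w dw ->
  is_derive t 1 (fun s => enorm (w s) ^+ 2)
    (2 * \sum_i w t ord0 i * dw ord0 i).
Proof.
move=> dwP; rewrite (_ : (fun _ => _) = \sum_i (fun s => w s ord0 i) ^+ 2).
  apply: is_derive_eq (is_derive_sum (fun i =>
    is_deriveX 2 (is_derive_coord ord0 i dwP))) _.
  rewrite mulr_sumr; apply: eq_bigr => i _.
  by rewrite expr1 /GRing.scale /= mulrA.
by apply/funext => s; rewrite sqr_enorm fct_sumE.
Qed.

(* Gronwall's inequality for the squared distance of the two solutions. *)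
Lemma lipschitz_ode_unique (R : realType) (n : nat) (F : 'rV[R]_n -> 'rV[R]_n)
  (A : set 'rV[R]_n) (L : R) (u v : R -> 'rV[R]_n) (b : R) :
  0 <= L -> L.-lipschitz_A F ->
  (forall t, 0 <= t <= b -> A (u t) /\ is_derive t 1 u (F (u t))) ->
  (forall t, 0 <= t <= b -> A (v t) /\ is_derive t 1 v (F (v t))) ->
  u 0 = v 0 -> forall t, 0 <= t <= b -> u t = v t.
Proof.
move=> L0 FL uP vP uv0 t tb.
pose w s := u s - v s.
pose dw s := F (u s) - F (v s).
pose g s := enorm (w s) ^+ 2.
pose dg s := 2 * \sum_i w s ord0 i * dw s ord0 i.
have dgP s : 0 <= s <= b -> is_derive s 1 g (dg s).
  move=> sb; have [[_ du] [_ dv]] := (uP s sb, vP s sb).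
  by apply: is_derive_sqr_enorm; apply: is_deriveB.
have norm_w_le s : `|w s| ^+ 2 <= g s.
  by rewrite lerXn2r ?nnegrE ?sqrtr_ge0 // mx_norm_le_enorm.
have dg_le s : 0 <= s <= b -> dg s <= 2 * (n%:R * L) * g s.
  move=> sb; have [[Au _] [Av _]] := (uP s sb, vP s sb).
  rewrite -!mulrA ler_pM2l // mulr_natl -[X in _ *+ X]card_ord -sumr_const.
  apply: ler_sum => i _; rewrite (le_trans (ler_norm _)) // normrM.
  apply: le_trans (ler_wpM2l L0 (norm_w_le s)); rewrite expr2 mulrCA.
  rewrite ler_pM ?mx_norm_coord_le // (le_trans (mx_norm_coord_le _ _ _)) //.
  exact: (FL (u s, v s)).
have gt_le0 : g t <= 0.
  apply: gronwall_le0 dgP dg_le _ t tb; first by rewrite !mulr_ge0.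
  by rewrite /g sqr_enorm /w uv0 subrr big1 // => i _; rewrite mxE expr0n.
apply/eqP; rewrite -subr_eq0 -normr_eq0 -sqrf_eq0 eq_le sqr_ge0 andbT.
exact: le_trans (norm_w_le t) gt_le0.
Qed.

Lemma smooth_ode_unique (R : realType) (n : nat) (F : 'rV[R]_n -> 'rV[R]_n)
  (u v : R -> 'rV[R]_n) (b : R) : smooth F ->
  (forall t, 0 <= t <= b -> is_derive t 1 u (F (u t))) ->
  (forall t, 0 <= t <= b -> is_derive t 1 v (F (v t))) ->
  u 0 = v 0 -> forall t, 0 <= t <= b -> u t = v t.
Proof.
move=> sF uP vP; pose A := u @` `[0, b] `|` v @` `[0, b].
have : bounded_set A.
  apply/compact_bounded/compactU; apply/continuous_compact/segment_compact.
    exact: is_derive_within_continuous uP.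
  exact: is_derive_within_continuous vP.
case/(smooth_lipschitz sF) => L L0 FL.
apply: lipschitz_ode_unique L0 FL _ _ => t tb; split; auto.
  by left; exists t; rewrite //= in_itv.
by right; exists t; rewrite //= in_itv.
Qed.

(** * Companion systems *)

Section UniqueZero.
Variables (R : realType) (g dg : R -> R) (C : R) (k : nat).
Hypothesis dgP : forall t : R, 0 <= t -> is_derive t 1 g (dg t).
Hypothesis dg_ge : forall t : R, 0 <= t -> C * t ^+ k <= dg t.

Lemma derive_ge_pow t : 0 <= t -> g 0 + C / k.+1%:R * t ^+ k.+1 <= g t.
Proof.
move=> t0; pose q s := g s - C / k.+1%:R * s ^+ k.+1.
suff : q 0 <= q t by rewrite /q expr0n mulr0 subr0 lerBrDr.
apply: (@is_derive_ge0_le _ q (fun s => dg s - C * s ^+ k)) => // s /andP[s0 _].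
  apply: is_deriveB; first exact: dgP.
  have powP : is_derive s 1 (@GRing.exp R ^~ k.+1) (k.+1%:R * s ^+ k).
    apply: DeriveDef; first exact: exprn_derivable.
    by rewrite exp_derive /GRing.scale /= mulr1.
  apply: is_derive_eq (is_deriveZ (C / k.+1%:R) powP) _.
  by rewrite /GRing.scale /= mulrA divfK // pnatr_eq0.
by rewrite subr_ge0 dg_ge // ltW.
Qed.

Hypothesis C_gt0 : 0 < C.

Lemma derive_ge_pow_increasing a b : 0 <= a -> a < b -> g a < g b.
Proof.
move=> a0 ab; apply: (is_derive_gt0_lt ab) => t /andP[at_ _].
  exact: dgP (le_trans a0 at_).
have t0 := le_lt_trans a0 at_.
by apply: lt_le_trans (dg_ge (ltW t0)); rewrite mulr_gt0 // exprn_gt0.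
Qed.

Lemma derive_ge_pow_unbounded (y : R) : exists2 b, 0 <= b & y <= g b.
Proof.
pose D := C / k.+1%:R.
have D0 : 0 < D by rewrite divr_gt0.
pose b := 1 + `|y - g 0| / D.
have b1 : 1 <= b by rewrite lerDl divr_ge0 // ltW.
have b0 : 0 <= b by apply: le_trans b1.
exists b => //; apply: le_trans (derive_ge_pow b0); rewrite -lerBlDl -/D.
apply: (@le_trans _ _ (D * b)); last by rewrite ler_pM2l // ler_eXnr.
rewrite /b mulrDr mulr1 mulrCA divff ?gt_eqF // mulr1.
by rewrite (le_trans (ler_norm _)) // lerDr ltW.
Qed.

Lemma derive_ge_pow_unique_zero : g 0 < 0 -> exists! t, 0 <= t /\ g t = 0.
Proof.
move=> g0; have [b b0 gb] := derive_ge_pow_unbounded 0.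
have g_cont : {within `[0, b], continuous g}.
  by apply: is_derive_within_continuous => t /andP[t0 _]; exact: dgP t0.
have [|t] := IVT b0 g_cont (v := 0).
  by rewrite ge_min le_max (ltW g0) gb orbT.
rewrite in_itv /= => /andP[t0 _] gt; exists t; split=> // s [s0 gs].
have [ts|st|//] := ltgtP t s.
- by have := derive_ge_pow_increasing t0 ts; rewrite gt gs ltxx.
- by have := derive_ge_pow_increasing s0 st; rewrite gt gs ltxx.
Qed.

End UniqueZero.

Section CompanionSystem.
Variables (R : realType) (p : nat) (delta : nat -> R) (c : R).

(* The first-order form x_i' = x_(i+1) of the scalar equation
   x^(p) = \sum_j delta_j x^(j) + c. *)
Definition companion_field (x : nat -> R) (i : nat) : R :=
  if (i.+1 < p)%N then x i.+1 else \sum_(j < p) delta j * x j + c.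

Definition companion_solution (psi : nat -> R -> R) : Prop :=
  forall i (t : R), (i < p)%N ->
    is_derive t 1 (psi i) (companion_field (psi ^~ t) i).

Let B (i j : nat) : R := if (i.+1 < p)%N then (j == i.+1)%:R else delta j.

Let companion_fieldB x y i : companion_field x i - companion_field y i =
  \sum_(j < p) B i j * (x j - y j).
Proof.
rewrite /companion_field /B; case: ifPn => [ip|_].
  rewrite (bigD1 (Ordinal ip)) //= eqxx mul1r big1 ?addr0 // => j.
  by rewrite -val_eqE /= => /negbTE ->; rewrite mul0r.
rewrite opprD addrACA subrr addr0 -sumrB.
by apply: eq_bigr => j _; rewrite mulrBr.
Qed.

Hypothesis delta_ge0 : forall i, (i < p)%N -> 0 <= delta i.

Let B_ge0 (i j : 'I_p) : 0 <= B i j.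
Proof. by rewrite /B; case: ifP => _; rewrite ?ler0n // delta_ge0. Qed.

Lemma companion_field_le x y i : (i < p)%N ->
  (forall j, (j < p)%N -> y j <= x j) ->
  companion_field y i <= companion_field x i.
Proof.
move=> ip yx; rewrite -subr_ge0 companion_fieldB; apply: sumr_ge0 => j _.
by rewrite mulr_ge0 ?subr_ge0 ?yx // (B_ge0 (Ordinal ip)).
Qed.

Variable psi : nat -> R -> R.
Hypothesis psiP : companion_solution psi.

Lemma subsolution_le_companion (b : R) (h dh : nat -> R -> R) :
  (forall i t, (i < p)%N -> 0 <= t <= b -> is_derive t 1 (h i) (dh i t)) ->
  (forall i t, (i < p)%N -> 0 <= t <= b ->
     dh i t <= companion_field (h ^~ t) i) ->
  (forall i, (i < p)%N -> h i 0 <= psi i 0) ->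
  forall i t, (i < p)%N -> 0 <= t <= b -> h i t <= psi i t.
Proof.
move=> dhP dh_le h0 i t ip tb; rewrite -subr_ge0.
apply: (@cooperative_ge0 _ 'I_p B b (fun i s => psi i s - h i s)
  (fun i s => companion_field (psi ^~ s) i - dh i s) _ _ _ _ (Ordinal ip)) =>
  // [j s sb|j s sb|j].
- by apply: is_deriveB; [exact: psiP|exact: dhP].
- by rewrite -(companion_fieldB (psi ^~ s) (h ^~ s)) lerD2l lerN2 dh_le.
- by rewrite subr_ge0 h0.
Qed.

Lemma lie_le_companion (n : nat) (F : 'rV[R]_n -> 'rV[R]_n)
  (phi : 'rV[R]_n -> R) (u : R -> 'rV[R]_n) (b : R) : smooth F -> smooth phi ->
  (forall t, 0 <= t <= b -> is_derive t 1 u (F (u t))) ->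
  (forall t, 0 <= t <= b -> lie F p phi (u t) <=
     \sum_(i < p) delta i * lie F i phi (u t) + c) ->
  (forall i, (i < p)%N -> lie F i phi (u 0) <= psi i 0) ->
  forall i t, (i < p)%N -> 0 <= t <= b -> lie F i phi (u t) <= psi i t.
Proof.
move=> sF sphi uP lie_le.
apply: (@subsolution_le_companion b (fun i t => lie F i phi (u t))
  (fun i t => lie F i.+1 phi (u t))) => i t ip tb.
  apply: (is_derive_comp_diff _ (uP t tb)).
  exact/smooth_differentiable/smooth_lie.
rewrite /companion_field; have [//|pi] := ltnP i.+1 p.
have <- : p = i.+1 by apply/eqP; rewrite eqn_leq pi ip.
exact: lie_le.
Qed.

Hypothesis p_gt0 : (0 < p)%N.
Hypothesis psi_ge0 : forall i, (0 < i < p)%N -> 0 <= psi i 0.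
Hypothesis initial_field_gt0 : 0 < delta 0%N * psi 0%N 0 + c.

(* The comparison function is constant: (psi 0 0, 0, ..., 0). *)
Lemma companion_last_ge t : 0 <= t ->
  delta 0%N * psi 0%N 0 + c <= companion_field (psi ^~ t) p.-1.
Proof.
move=> t0; pose v i := if i == 0%N then psi 0%N 0 else 0.
have field_last : companion_field v p.-1 = delta 0%N * psi 0%N 0 + c.
  rewrite /companion_field prednK // ltnn (bigD1 (Ordinal p_gt0)) //=.
  by rewrite big1 ?addr0 // => -[[|j] jp] //= _; rewrite /v /= mulr0.
rewrite -field_last; apply: companion_field_le => [|j jp].
  by rewrite prednK.
apply: (@subsolution_le_companion t (fun i _ => v i) (fun _ _ => 0)) => //.
- move=> i s ip _; have [ip'|pi] := ltnP i.+1 p.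
    by rewrite /companion_field ip'.
  have -> : i = p.-1 by apply/eqP; rewrite -eqSS prednK // eqn_leq ip pi.
  by rewrite field_last ltW.
- by move=> [|i] ip; rewrite /v //= psi_ge0.
- by rewrite t0 lexx.
Qed.

Lemma companion_field_ge_pow k : (k < p)%N ->
  exists2 C, 0 < C &
    forall t, 0 <= t -> C * t ^+ k <= companion_field (psi ^~ t) (p.-1 - k).
Proof.
elim: k => [_|k ih kp].
  exists (delta 0%N * psi 0%N 0 + c) => // t t0.
  by rewrite expr0 mulr1 subn0; exact: companion_last_ge.
have [C C0 field_ge] := ih (ltnW kp).
exists (C / k.+1%:R) => [|t t0]; first by rewrite divr_gt0.
have pkE : (p.-1 - k.+1).+1 = (p.-1 - k)%N.
  by rewrite subnS prednK // subn_gt0 -ltnS prednK.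
have pk : (p.-1 - k < p)%N by rewrite (leq_ltn_trans (leq_subr _ _)) // prednK.
rewrite /companion_field pkE pk.
have := derive_ge_pow (fun s _ => psiP s pk) field_ge t0.
by apply: le_trans; rewrite lerDr psi_ge0 // pk -pkE.
Qed.

Lemma companion_unique_zero : psi 0%N 0 < 0 ->
  exists! t, 0 <= t /\ psi 0%N t = 0.
Proof.
have [|C C0] := @companion_field_ge_pow p.-1; first by rewrite prednK.
rewrite subnn => field_ge.
exact: derive_ge_pow_unique_zero (fun t _ => psiP t p_gt0) field_ge C0.
Qed.

End CompanionSystem.

Section CompanionFlow.
Variables (R : realType) (p : nat) (delta : nat -> R).
Implicit Types v w : 'cV[R]_p.+1.

Definition companion_flow v (i : nat) (t : R) : R :=
  (expm (t *: Amat p delta) *m v) (inord i) ord0.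

Lemma companion_flow0 v i : companion_flow v i 0 = v (inord i) ord0.
Proof. by rewrite /companion_flow scale0r expm0 mul1mx. Qed.

Lemma Amat_mulmx w i : (i < p)%N -> (Amat p delta *m w) (inord i) ord0 =
  companion_field p delta (w ord_max ord0) (fun j => w (inord j) ord0) i.
Proof.
move=> ip; have iE : nat_of_ord (inord i : 'I_p.+1) = i.
  by rewrite inordK // ltnS ltnW.
rewrite mxE /companion_field; have [ip'|pi] := ltnP i.+1 p.
  rewrite (bigD1 (inord i.+1)) //= mxE iE ip' inordK ?ltnS // eqxx mul1r.
  rewrite big1 ?addr0 // => j; rewrite mxE iE ip' -val_eqE /= inordK ?ltnS //.
  by move=> /negbTE ->; rewrite mul0r.
have ipE : i == p.-1.
  by rewrite -eqSS prednK ?(leq_ltn_trans _ ip) // eqn_leq ip pi.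
have AE j : Amat p delta (inord i) j = if (j < p)%N then delta j else 1.
  by rewrite mxE iE ltnNge pi /= ipE.
rewrite big_ord_recr /= AE ltnn mul1r; congr (_ + _).
apply: eq_bigr => j _; rewrite AE /= ltn_ord; congr (_ * w _ _).
by apply: val_inj; rewrite /= inordK // ltnS ltnW.
Qed.

Lemma Amat_mulmx_last w : (0 < p)%N -> (Amat p delta *m w) ord_max ord0 = 0.
Proof.
move=> p0; rewrite mxE big1 // => j _; rewrite mxE /= ltnNge leqnSn /=.
by rewrite gtn_eqF ?mul0r // prednK.
Qed.

Lemma companion_flow_last v t : (0 < p)%N ->
  companion_flow v p t = v ord_max ord0.
Proof.
move=> p0; have lastE : inord p = ord_max :> 'I_p.+1.
  by apply: val_inj; rewrite /= inordK.
transitivity (companion_flow v p 0); last by rewrite companion_flow0 lastE.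
apply: is_derive_0_is_cst => s; rewrite /companion_flow lastE.
apply: is_derive_eq (is_derive_expm_mulmx _ v s _ _) _.
exact: Amat_mulmx_last.
Qed.

Lemma companion_flow_solution v :
  companion_solution p delta (v ord_max ord0) (companion_flow v).
Proof.
move=> i t ip; have p0 : (0 < p)%N by apply: leq_ltn_trans ip.
apply: is_derive_eq (is_derive_expm_mulmx _ v t _ _) _.
rewrite Amat_mulmx //; congr (companion_field _ _ _ _ _).
rewrite -(companion_flow_last v t p0); congr ((_ *m _) _ _).
by apply: val_inj; rewrite /= inordK.
Qed.

End CompanionFlow.

(** * The bounding function *)

Section SphereProjection.
Variables (R : realType) (n : nat) (r : R).
Implicit Types (x : 'rV[R]_n) (lam : R).

Definition sphere_proj x : 'rV[R]_n := r / enorm x *: x.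

Lemma sphere_projZ lam x : 0 < lam -> sphere_proj (lam *: x) = sphere_proj x.
Proof.
move=> lam0; rewrite /sphere_proj enormZ ?(ltW lam0) // scalerA invfM.
by rewrite -mulrA mulrAC mulVf ?gt_eqF // mul1r.
Qed.

Hypothesis r_gt0 : 0 < r.

Lemma sphere_proj_neq0 x : x != 0 -> sphere_proj x != 0.
Proof.
move=> x0; rewrite scaler_eq0 negb_or x0 andbT gt_eqF //.
by rewrite divr_gt0 ?enorm_gt0.
Qed.

Lemma enorm_sphere_proj x : x != 0 -> enorm (sphere_proj x) = r.
Proof.
move=> /enorm_gt0 x0; rewrite enormZ ?divfK ?gt_eqF //.
by rewrite ltW // divr_gt0.
Qed.

Lemma scale_sphere_proj x : x != 0 -> enorm x / r *: sphere_proj x = x.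
Proof.
move=> /enorm_gt0 x0; rewrite scalerA mulrA divfK ?gt_eqF //.
by rewrite divff ?scale1r // gt_eqF.
Qed.

End SphereProjection.

Section BoundingFunction.
Variables (R : realType) (n p : nat).
Variables (F : 'rV[R]_(n + n) -> 'rV[R]_(n + n)) (phi : 'rV[R]_(n + n) -> R).
Variables (delta : nat -> R) (alpha theta r : R).
Implicit Types (x y : 'rV[R]_n) (t lam : R).

Definition sphere_bound y : nat -> R -> R :=
  companion_flow delta (mu_vec p F phi delta y).

Local Notation mu := (mu p F phi delta alpha theta r).

Lemma muE x t : mu x t = (enorm x / r) `^ (theta + 1) *
  sphere_bound (sphere_proj r x) 0 ((enorm x / r) `^ alpha * t).
Proof.
rewrite /Defs.mu -scalemxAr -scalemxAl mxE -mulmxA; congr (_ * _).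
rewrite mxE (bigD1 (inord 0)) //= mxE inordK // eqxx mul1r.
rewrite big1 ?addr0 // => j; rewrite mxE -val_eqE /= inordK // => /negbTE ->.
by rewrite mul0r.
Qed.

Lemma mu_homogeneous x t lam : 0 < r -> 0 < lam ->
  mu (lam *: x) t = lam `^ (theta + 1) * mu x (lam `^ alpha * t).
Proof.
move=> r0 lam0; have lam_ge0 := ltW lam0.
have s_ge0 : 0 <= enorm x / r by rewrite divr_ge0 ?sqrtr_ge0 // ltW.
rewrite !muE sphere_projZ // enormZ // -mulrA !(powRM _ lam_ge0 s_ge0) -mulrA.
by congr (_ * (_ * sphere_bound _ _ _)); ring.
Qed.

Lemma sphere_bound00 y : sphere_bound y 0 0 = phi (pair_st y 0).
Proof. by rewrite /sphere_bound companion_flow0 mxE inordK. Qed.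

Lemma sphere_bound0_max y i : (0 < i < p)%N ->
  sphere_bound y i 0 = Num.max (lie F i phi (pair_st y 0)) 0.
Proof.
move=> /andP[i0 ip]; rewrite /sphere_bound companion_flow0 mxE.
by rewrite inordK ?ip ?gtn_eqF // ltnW.
Qed.

Lemma sphere_bound_solution y :
  companion_solution p delta (delta p) (sphere_bound y).
Proof.
have [->|p0] := posnP p; first by case.
suff -> : delta p = mu_vec p F phi delta y ord_max ord0.
  exact: companion_flow_solution.
by rewrite mxE /= ltnn gtn_eqF.
Qed.

Lemma lie_le_sphere_bound y i : (i < p)%N ->
  lie F i phi (pair_st y 0) <= sphere_bound y i 0.
Proof.
case: i => [|i] ip; first by rewrite sphere_bound00.
by rewrite sphere_bound0_max // le_max lexx.
Qed.

Lemma mu_lt0 x : 0 < r -> x != 0 ->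
  phi (pair_st (sphere_proj r x) 0) < 0 -> mu x 0 < 0.
Proof.
move=> r0 /enorm_gt0 x0 phi_lt0; rewrite muE mulr0 sphere_bound00.
by rewrite pmulr_rlt0 ?powR_gt0 ?divr_gt0.
Qed.

Lemma mu_unique_zero x : 0 < r -> x != 0 -> (0 < p)%N ->
  (forall i, (i < p)%N -> 0 <= delta i) ->
  0 < delta 0%N * phi (pair_st (sphere_proj r x) 0) + delta p ->
  phi (pair_st (sphere_proj r x) 0) < 0 ->
  exists! t, 0 <= t /\ mu x t = 0.
Proof.
move=> r0 /enorm_gt0 x0 p0 delta_ge0.
set y := sphere_proj r x => delta_gt0 phi_lt0.
have s0 : 0 < enorm x / r by rewrite divr_gt0.
have [|||t [[t0 yt0] t_unique]] :=
  companion_unique_zero delta_ge0 (@sphere_bound_solution y) p0.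
- by move=> i ip; rewrite sphere_bound0_max // le_max lexx orbT.
- by rewrite sphere_bound00.
- by rewrite sphere_bound00.
have k0 := powR_gt0 alpha s0.
exists (t / (enorm x / r) `^ alpha); split.
  split; first by rewrite divr_ge0 // ltW.
  by rewrite muE mulrCA divff ?gt_eqF // mulr1 yt0 mulr0.
move=> u [u0]; rewrite muE => /eqP.
rewrite mulf_eq0 gt_eqF ?powR_gt0 //= => /eqP yu0.
have -> : t = (enorm x / r) `^ alpha * u.
  by apply: t_unique; rewrite mulr_ge0 // ltW.
by rewrite mulrC mulKf // gt_eqF.
Qed.

End BoundingFunction.

(** * Triggering times *)

Section HomogeneousFlow.
Variables (R : realType) (n : nat) (F : 'rV[R]_n -> 'rV[R]_n) (alpha : R).
Hypotheses (sF : smooth F) (hF : homogeneous alpha F).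
Implicit Types (T : \bar R) (u v : R -> 'rV[R]_n).

Definition solves T u : Prop :=
  forall t : R, 0 <= t -> (t%:E < T)%E -> is_derive t 1 u (F (u t)).

Lemma solves_on T u b : solves T u -> (b%:E < T)%E ->
  forall t : R, 0 <= t <= b -> is_derive t 1 u (F (u t)).
Proof.
move=> uP bT t /andP[t0 tb]; apply: uP => //.
by apply: le_lt_trans bT; rewrite lee_fin.
Qed.

Lemma is_derive_time_scaling u (s t : R) : 0 < s ->
  is_derive (s `^ alpha * t) 1 u (F (u (s `^ alpha * t))) ->
  is_derive t 1 (fun t => s *: u (s `^ alpha * t))
    (F (s *: u (s `^ alpha * t))).
Proof.
move=> s0; set k := s `^ alpha => -[du uE].
have du' : differentiable u (k * t) by apply/derivable1_diffP.
apply: is_derive_eq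
  (is_deriveZ s (is_derive_comp_diff du' (is_derive_mulrl k t))) _.
rewrite deriveE // -[k in 'd _ _ k]mulr1 -[k * 1]/(k *: (1 : R)) linearZ /=.
rewrite -deriveE // uE hF // powRD; last by rewrite (gt_eqF s0) implybT.
by rewrite powRr1 ?(ltW s0) // scalerA mulrC.
Qed.

Lemma homogeneous_flow (s : R) Tu Tv u v t : 0 < s ->
  solves Tu u -> solves Tv v -> v 0 = s *: u 0 -> 0 <= t ->
  (t%:E < Tv)%E -> ((s `^ alpha * t)%:E < Tu)%E ->
  v t = s *: u (s `^ alpha * t).
Proof.
move=> s0 uP vP uv0 t0 tTv tTu.
apply: (smooth_ode_unique sF (solves_on vP tTv)
  (v := fun w => s *: u (s `^ alpha * w))); rewrite ?mulr0 ?t0 ?lexx //.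
move=> w /andP[w0 wt]; apply: is_derive_time_scaling s0 _.
apply: (solves_on uP tTu).
by rewrite mulr_ge0 ?powR_ge0 // ler_wpM2l ?powR_ge0.
Qed.

End HomogeneousFlow.

Section TriggeringTime.
Variables (R : realType) (n : nat) (phi : 'rV[R]_(n + n) -> R).
Variables (xi : 'rV[R]_n -> R -> 'rV[R]_(n + n)) (T : 'rV[R]_n -> \bar R).
Implicit Types (x : 'rV[R]_n) (t : R).

Definition triggers x t : Prop :=
  0 < t /\ (t%:E < T x)%E /\ phi (xi x t) = 0.

Local Notation tau := (trig_time phi xi T).

Lemma trig_time_le x t : triggers x t -> tau x <= t.
Proof. by move=> xt; apply: ge_inf xt; exists 0 => s [/ltW]. Qed.

Lemma le_trig_time x t : (exists s, triggers x s) ->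
  (forall s, triggers x s -> t <= s) -> t <= tau x.
Proof. exact: lb_le_inf. Qed.

Lemma trig_time_lt x t : (exists s, triggers x s) -> t <= tau x ->
  (t%:E < T x)%E.
Proof.
case=> s xs t_le; have [_ [sT _]] := xs; apply: le_lt_trans sT.
by rewrite lee_fin (le_trans t_le) // trig_time_le.
Qed.

Variable F : 'rV[R]_(n + n) -> 'rV[R]_(n + n).
Hypothesis sphi : smooth phi.
Hypothesis xiP : forall x, solves F (T x) (xi x).

Lemma phi_le0_before_trig_time x t : phi (xi x 0) < 0 ->
  (exists s, triggers x s) -> 0 <= t <= tau x -> phi (xi x t) <= 0.
Proof.
move=> phi0 x_trig /andP[t0 t_tau]; rewrite leNgt; apply/negP => phi_t.
have tT := trig_time_lt x_trig t_tau.
have phi_cont : {within `[0, t], continuous (phi \o xi x)}.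
  apply: (@is_derive_within_continuous _ _ _
    (fun s => 'D_(F (xi x s)) phi (xi x s))) => s st.
  apply: is_derive_comp_diff; first exact: smooth_differentiable.
  exact: solves_on (@xiP x) tT s st.
have [|s] := IVT t0 phi_cont (v := 0).
  by rewrite /= ge_min le_max (ltW phi0) (ltW phi_t) orbT.
rewrite in_itv /= => /andP[s0 st] phi_s.
have {}s0 : 0 < s.
  by rewrite lt_neqAle s0 andbT; apply/eqP => sE;
    rewrite [X in xi x X]sE [phi _]phi_s ltxx in phi0.
have {}st : s < t.
  by rewrite lt_neqAle st andbT; apply/eqP => sE;
    rewrite -sE [phi _]phi_s ltxx in phi_t.
have : tau x <= s.
  apply: trig_time_le; do 2![split=> //].
  exact: trig_time_lt x_trig (le_trans (ltW st) t_tau).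
by rewrite leNgt (lt_le_trans st).
Qed.

Variables alpha theta : R.
Hypotheses (sF : smooth F) (hF : homogeneous alpha F).
Hypothesis hphi : homogeneous theta phi.

Lemma phi_scaling (s : R) x y t : 0 < s -> xi x 0 = s *: xi y 0 ->
  0 <= t -> (t%:E < T x)%E -> ((s `^ alpha * t)%:E < T y)%E ->
  phi (xi x t) = s `^ (theta + 1) * phi (xi y (s `^ alpha * t)).
Proof.
move=> s0 xy0 t0 tTx tTy.
by rewrite (homogeneous_flow sF hF s0 (@xiP y) (@xiP x) xy0 t0 tTx tTy) hphi.
Qed.

Lemma trig_time_scaling_le (s : R) x y : 0 < s -> xi x 0 = s *: xi y 0 ->
  (exists t, triggers x t) -> (exists t, triggers y t) ->
  s `^ alpha * tau x <= tau y.
Proof.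
move=> s0 xy0 x_trig y_trig; have k0 : 0 < s `^ alpha by rewrite powR_gt0.
apply: le_trig_time y_trig _ => t [t0 [tT phi_t]].
rewrite -ler_pdivlMl //; apply: contraT; rewrite -ltNge => t_tau.
have tk0 : 0 < (s `^ alpha)^-1 * t by rewrite mulr_gt0 ?invr_gt0.
have tkT := trig_time_lt x_trig (ltW t_tau).
have kE : s `^ alpha * ((s `^ alpha)^-1 * t) = t by rewrite mulVKf ?gt_eqF.
suff : tau x <= (s `^ alpha)^-1 * t by rewrite leNgt t_tau.
apply: trig_time_le; do 2![split=> //].
by rewrite (phi_scaling s0 xy0 (ltW tk0)) ?kE // phi_t mulr0.
Qed.

Hypothesis xi0 : forall x, xi x 0 = pair_st x 0.
Hypothesis xi_trig : forall x, x != 0 -> exists t, triggers x t.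

Variables (p : nat) (delta : nat -> R) (r : R).
Hypotheses (p_gt0 : (0 < p)%N) (r_gt0 : 0 < r).
Hypothesis delta_ge0 : forall i, (i < p)%N -> 0 <= delta i.

Lemma phi_le_mu x t : x != 0 ->
  (forall s, 0 <= s <= tau (sphere_proj r x) ->
     lie F p phi (xi (sphere_proj r x) s) <=
       \sum_(i < p) delta i * lie F i phi (xi (sphere_proj r x) s) + delta p) ->
  0 <= t <= tau x -> phi (xi x t) <= mu p F phi delta alpha theta r x t.
Proof.
move=> x0; set y := sphere_proj r x => lie_le /andP[t0 t_tau].
have y_trig := xi_trig (sphere_proj_neq0 r_gt0 x0).
have s0 : 0 < enorm x / r by rewrite divr_gt0 ?enorm_gt0.
have xy0 : xi x 0 = enorm x / r *: xi y 0.
  by rewrite !xi0 /pair_st scale_row_mx scaler0 scale_sphere_proj.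
have kt0 : 0 <= (enorm x / r) `^ alpha * t by rewrite mulr_ge0 ?powR_ge0.
have kt_tau : (enorm x / r) `^ alpha * t <= tau y.
  apply: le_trans (trig_time_scaling_le s0 xy0 (xi_trig x0) y_trig).
  by rewrite ler_wpM2l ?powR_ge0.
have ktT := trig_time_lt y_trig kt_tau.
rewrite (phi_scaling s0 xy0 t0 (trig_time_lt (xi_trig x0) t_tau) ktT).
rewrite muE ler_pM2l ?powR_gt0 //.
apply: (lie_le_companion delta_ge0 (sphere_bound_solution F phi delta y) sF sphi
  (solves_on (@xiP y) ktT) _ _ p_gt0) => [u /andP[u0 ukt]|i ip|].
- by apply: lie_le; rewrite u0 (le_trans ukt).
- by rewrite xi0; exact: lie_le_sphere_bound.
- by rewrite kt0 lexx.
Qed.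

End TriggeringTime.

Unset Implicit Arguments.

Theorem theorem3 (R : realType) (n m : nat)
  (f : 'rV[R]_n -> 'rV[R]_m -> 'rV[R]_n) (ups : 'rV[R]_n -> 'rV[R]_m)
  (phi : 'rV[R]_(n + n) -> R) (alpha theta : R)
  (xi : 'rV[R]_n -> R -> 'rV[R]_(n + n)) (T : 'rV[R]_n -> \bar R)
  (Z : set 'rV[R]_n) (Xi : set 'rV[R]_(n + n))
  (d : R) (p : nat) (eps : R) (delta : nat -> R) (r : R) :
  (* (i) F smooth and homogeneous of degree alpha >= 1 *)
  smooth (Fcl f ups) -> 1 <= alpha -> homogeneous alpha (Fcl f ups) ->
  (* (ii) phi smooth and homogeneous of degree theta >= 1 *)
  smooth phi -> 1 <= theta -> homogeneous theta phi ->
  (* xi(.;x) solves d/dt xi = F(xi), xi(0;x) = (x,0), on [0, T x) *)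
  (forall x, (0%:E < T x)%E) ->
  (forall x, xi x 0 = pair_st x 0) ->
  (forall x t, 0 <= t -> (t%:E < T x)%E ->
     is_derive t 1 (xi x) (Fcl f ups (xi x t))) ->
  (* (iii) *)
  (forall x, x != 0 -> phi (pair_st x 0) < 0 /\
     exists tx, 0 < tx /\ (tx%:E < T x)%E /\ phi (xi x tx) = 0) ->
  (* (iv) *)
  compact Z -> nbhs (0 : 'rV[R]_n) Z -> compact Xi -> nbhs (0 : 'rV[R]_(n + n)) Xi ->
  (forall x t, Z x -> 0 <= t -> (t%:E < T x)%E ->
     phi (xi x t) <= 0 -> Xi (xi x t)) ->
  (* (v) the origin is the only equilibrium of zeta' = f(zeta, ups(zeta)) *)
  (forall zeta, f zeta (ups zeta) = 0 <-> zeta = 0) ->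
  (* the data of the theorem *)
  0 < d -> Xi `<=` [set z | enorm z < d] ->
  (1 <= p)%N -> 0 < eps ->
  (forall z, enorm z < d ->
     lie (Fcl f ups) p phi z <=
       \sum_(i < p) delta i * lie (Fcl f ups) i phi z + delta p) ->
  (forall x, Z x -> delta 0%N * phi (pair_st x 0) + delta p >= eps) ->
  (forall i, (i <= p)%N -> 0 <= delta i) ->
  0 < r -> [set x : 'rV[R]_n | enorm x = r] `<=` Z ->
  let mu := mu p (Fcl f ups) phi delta alpha theta r in
  let tau := trig_time phi xi T in
  (* (a) *) (forall x, x != 0 -> mu x 0 < 0) /\
  (* (b) *) (forall x t, x != 0 -> 0 <= t <= tau x -> phi (xi x t) <= mu x t) /\
  (* (c) *) (forall x t lam, x != 0 -> 0 < t -> 0 < lam ->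
               mu (lam *: x) t = lam `^ (theta + 1) * mu x (lam `^ alpha * t)) /\
  (* (d) *) (forall x, x != 0 -> exists! tx, 0 <= tx /\ mu x tx = 0).
Proof.
move=> sF _ hF sphi _ hphi _ xi0 xiP phiP _ _ _ _ ZXi _ _ Xi_d p1 eps0 lie_le
  eps_le delta_ge0 r0 rZ mu tau.
have {}delta_ge0 i : (i < p)%N -> 0 <= delta i by move=> /ltnW/delta_ge0.
have phi_lt0 (x : 'rV[R]_n) : x != 0 -> phi (pair_st x 0) < 0 by case/phiP.
have xi_trig (x : 'rV[R]_n) : x != 0 -> exists t, triggers phi xi T x t.
  by case/phiP.
have y_neq0 (x : 'rV[R]_n) := sphere_proj_neq0 r0 (x := x).
have Zy (x : 'rV[R]_n) : x != 0 -> Z (sphere_proj r x).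
  by move=> x0; apply: rZ; exact: enorm_sphere_proj.
split; [|split; [|split]] => [x x0|x t x0|x t lam _ _ lam0|x x0].
- by apply: mu_lt0 => //; exact/phi_lt0/y_neq0.
- apply: (phi_le_mu sphi xiP sF hF hphi xi0 xi_trig) => // s /andP[s0 s_tau].
  apply/lie_le/Xi_d/ZXi => //; first exact: Zy.
  + exact: trig_time_lt (xi_trig _ (y_neq0 x x0)) s_tau.
  + apply: (phi_le0_before_trig_time sphi xiP) (xi_trig _ (y_neq0 x x0)) _.
      by rewrite xi0 phi_lt0 // y_neq0.
    by rewrite s0.
- exact: mu_homogeneous.
- apply: mu_unique_zero => //; last exact/phi_lt0/y_neq0.
  exact: lt_le_trans eps0 (eps_le _ (Zy x x0)).
Qed.
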